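(* Let $\mathcal{M}_2(\mathbb{Z}_m)$ be the ring of $2\times 2$ matrices over the ring $\mathbb{Z}_m$ of integers modulo $m$. Let $X$ be the subring $$X=\left\{\begin{pmatrix} 0 & 0 \\ 0 & 0 \end{pmatrix}, \begin{pmatrix} 2 & 0 \\ 0 & 0 \end{pmatrix}, \begin{pmatrix} 0 & 0 \\ 0 & 2 \end{pmatrix}, \begin{pmatrix} 2 & 0 \\ 0 & 2 \end{pmatrix}\right\}$$ of $\mathcal{M}_2(\mathbb{Z}_4)$, and let $Y$ and $Z$ be the subrings of $\mathcal{M}_2(\mathbb{Z}_2)$ defined by $$Y=\left\{\begin{pmatrix} 0 & 0 \\ 0 & 0 \end{pmatrix}, \begin{pmatrix} 1 & 0 \\ 0 & 0 \end{pmatrix}, \begin{pmatrix} 0 & 1 \\ 0 & 0 \end{pmatrix}, \begin{pmatrix} 1 & 1 \\ 0 & 0 \end{pmatrix}\right\},$$ $$Z=\left\{\begin{pmatrix} 0 & 0 \\ 0 & 0 \end{pmatrix}, \begin{pmatrix} 0 & 1 \\ 0 & 0 \end{pmatrix}, \begin{pmatrix} 0 & 0 \\ 0 & 1 \end{pmatrix}, \begin{pmatrix} 0 & 1 \\ 0 & 1 \end{pmatrix}\right\}.$$ Then for any ring $R$ (associative, not necessarily commutative or unital), we have \begin{itemize} \item $\eta(R)=3$ if and only if $R$ has a factor ring isomorphic to $X$. \item $\eta_\ell(R)=3$ if and only if $R$ has a factor ring isomorphic to either $X$ or $Y$. \item $\eta_r(R)=3$ if and only if $R$ has a factor ring isomorphic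 to either $X$ or $Z$. \end{itemize}
   Context: A ring is a set $R$ with binary operations $+$ and $\cdot$ such that $(R,+)$ is an abelian group, multiplication is associative, and both distributive laws hold; rings are not assumed to be commutative or to have a multiplicative identity. A subring is an additive subgroup closed under multiplication (it need not contain an identity). A left (resp. right) ideal of $R$ is an additive subgroup of $R$ closed under left (resp. right) multiplication by elements of $R$; a two-sided ideal is an additive subgroup that is both a left and a right ideal. An ideal is proper if it is not equal to $R$. A factor ring of $R$ is a quotient $R/I$ by a two-sided ideal $I$; isomorphisms are isomorphisms of (not necessarily unital) rings. For a ring $R$, the ideal covering numbers $\eta_\ell(R)$, $\eta_r(R)$, $\eta(R)$ are the minimal numbers of proper left, proper right, and proper two-sided ideals of $R$, respectively, whose union equals $R$; if no such (finite) cover exists, the corresponding number is defined to be $\infty$. *)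

(* Defs.v *)
From HB Require Import structures.
From mathcomp Require Import all_boot all_order all_algebra.
From mathcomp Require Import ring_quotient generic_quotient.
From mathcomp Require Import boolp classical_sets cardinality.

Set Implicit Arguments.
Unset Strict Implicit.
Unset Printing Implicit Defensive.

Import GRing.Theory.
Local Open Scope classical_set_scope.
Local Open Scope ring_scope.
Local Open Scope quotient_scope.

(* ssralg's ring structures all have a 1; an [rngType] is an associative ring
   that need be neither unital nor commutative. *)
HB.mixin Record Zmodule_isRng R of GRing.Zmodule R := {
  rngmul : R -> R -> R;
  rngmulA : associative rngmul;
  rngmulDl : left_distributive rngmul +%R;
  rngmulDr : right_distributive rngmul +%R
}.

#[short(type="rngType")]
HB.structure Definition Rng := {R of Zmodule_isRng R & GRing.Zmodule R}.

Notation "x ** y" := (rngmul x y) (at level 40, left associativity) : ring_scope.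

Section RngTheory.
Variable R : rngType.
Implicit Types x y z : R.

Lemma rngmulBl x y z : (x - y) ** z = x ** z - y ** z.
Proof. by apply: (addIr (y ** z)); rewrite -rngmulDl !subrK. Qed.

Lemma rngmulBr x y z : z ** (x - y) = z ** x - z ** y.
Proof. by apply: (addIr (z ** y)); rewrite -rngmulDr !subrK. Qed.

End RngTheory.

Definition rng_isomorphic (R S : rngType) : Prop :=
  exists f : R -> S,
    [/\ {morph f : x y / x + y}, {morph f : x y / x ** y} & bijective f].

Section Ideals.
Variable R : rngType.
Implicit Type I : set R.

Definition additive_subgroup I : Prop :=
  I 0 /\ forall x y, I x -> I y -> I (x - y).

Definition left_ideal I : Prop :=
  additive_subgroup I /\ forall a x, I x -> I (a ** x).

Definition right_ideal I : Prop :=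
  additive_subgroup I /\ forall a x, I x -> I (x ** a).

Definition two_sided_ideal I : Prop := left_ideal I /\ right_ideal I.

Definition proper_cover (P : set R -> Prop) (C : set (set R)) : Prop :=
  (forall I, C I -> P I /\ I <> [set: R]) /\ \bigcup_(I in C) I = [set: R].

(* [n] is the cardinality of a set [C] of ideals, so infinite covers are excluded
   and no ideal is counted twice. *)
Definition cover_size (P : set R -> Prop) (n : nat) : Prop :=
  exists C : set (set R), proper_cover P C /\ (C #= `I_n)%card.

End Ideals.

(* The least element of a set of natural numbers; [None], standing for
   infinity, when the set is empty. *)
Definition least (P : nat -> Prop) : option nat :=
  if pselect (exists n, `[< P n >]) is left exP then Some (ex_minn exP)
  else None.

Lemma leastP (P : nat -> Prop) n :
  least P = Some n <-> P n /\ forall m, P m -> (n <= m)%N.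
Proof.
rewrite /least; case: pselect => [exP|nexP].
  case: ex_minnP => k Pk kmin; split=> [[<-]|[Pn nmin]].
    by split=> [|m Pm]; [exact/asboolP|apply/kmin/asboolP].
  by congr Some; apply/eqP; rewrite eqn_leq (nmin k) ?andbT;
    [apply/kmin/asboolP|exact/asboolP].
by split=> // -[Pn _]; case: nexP; exists n; apply/asboolP.
Qed.

Lemma least_None (P : nat -> Prop) : least P = None <-> forall n, ~ P n.
Proof.
rewrite /least; case: pselect => [exP|nexP]; split=> //.
  by case: (exP) => n Pn nP; case: (nP n); apply/asboolP.
by move=> _ n Pn; apply: nexP; exists n; apply/asboolP.
Qed.

Definition eta_l (R : rngType) : option nat :=
  least (cover_size (@left_ideal R)).
Definition eta_r (R : rngType) : option nat :=
  least (cover_size (@right_ideal R)).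
Definition eta (R : rngType) : option nat :=
  least (cover_size (@two_sided_ideal R)).

Record tsideal (R : rngType) := TSIdeal {
  tsideal_set : set R;
  tsidealP : two_sided_ideal tsideal_set
}.

Section FactorRing.
Variables (R : rngType) (I : tsideal R).

Definition tsideal_pred : {pred R} := fun x => `[< tsideal_set I x >].

Lemma tsideal_predE x : (x \in tsideal_pred) = `[< tsideal_set I x >].
Proof. by []. Qed.

Lemma tsideal_zmod_closed : zmod_closed tsideal_pred.
Proof.
have [[[I0 IB] _] _] := tsidealP I.
split=> [|x y]; rewrite !tsideal_predE; first exact/asboolP.
by move=> /asboolP Ix /asboolP Iy; apply/asboolP/IB.
Qed.

Definition tsideal_zmod : zmodClosed R :=
  HB.pack tsideal_pred
    (GRing.isZmodClosed.Build R tsideal_pred tsideal_zmod_closed).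

Definition factor_ring : Type := Quotient.quot tsideal_zmod.
HB.instance Definition _ := GRing.Zmodule.on factor_ring.

Definition coset (x : R) : factor_ring := \pi_(Quotient.quot tsideal_zmod) x.

Definition coset_repr (u : factor_ring) : R :=
  repr (u : Quotient.quot tsideal_zmod).

Lemma coset_reprK : cancel coset_repr coset.
Proof. exact: reprK. Qed.

Lemma coset_eqP x y : coset x = coset y <-> tsideal_set I (x - y).
Proof.
have E : (coset x == coset y) = (x - y \in tsideal_pred).
  by apply/esym; exact: (@Quotient.idealrBE _ tsideal_zmod).
split=> [/eqP|Ixy]; last apply/eqP; rewrite E tsideal_predE.
  by move/asboolP.
exact/asboolP.
Qed.

Lemma cosetD x y : coset (x + y) = coset x + coset y.
Proof. exact: Quotient.pi_add. Qed.

Definition factor_mul (u v : factor_ring) : factor_ring :=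
  coset (coset_repr u ** coset_repr v).

Lemma factor_mulE x y : factor_mul (coset x) (coset y) = coset (x ** y).
Proof.
have [[[I0 IB] IMl] [_ IMr]] := tsidealP I.
have Ir z : tsideal_set I (z - coset_repr (coset z)).
  by apply/coset_eqP; rewrite coset_reprK.
apply/esym/coset_eqP; set x' := coset_repr _; set y' := coset_repr _.
have -> : x ** y - x' ** y' = (x - x') ** y - x' ** (y' - y).
  by rewrite rngmulBl rngmulBr opprB addrA subrK.
apply: (IB); first exact/IMr/Ir.
by apply: IMl; rewrite -opprB -sub0r; apply: IB => //; apply: Ir.
Qed.

Lemma factor_mulA : associative factor_mul.
Proof.
move=> u v w; rewrite -[u]coset_reprK -[v]coset_reprK -[w]coset_reprK.
by rewrite !factor_mulE rngmulA.
Qed.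

Lemma factor_mulDl : left_distributive factor_mul +%R.
Proof.
move=> u v w; rewrite -[u]coset_reprK -[v]coset_reprK -[w]coset_reprK.
by rewrite !factor_mulE -!cosetD factor_mulE rngmulDl.
Qed.

Lemma factor_mulDr : right_distributive factor_mul +%R.
Proof.
move=> u v w; rewrite -[u]coset_reprK -[v]coset_reprK -[w]coset_reprK.
by rewrite !factor_mulE -!cosetD factor_mulE rngmulDr.
Qed.

HB.instance Definition _ :=
  Zmodule_isRng.Build factor_ring factor_mulA factor_mulDl factor_mulDr.

Lemma cosetM x y : coset (x ** y) = coset x ** coset y.
Proof. exact/esym/factor_mulE. Qed.

End FactorRing.

Definition has_factor_ring_isomorphic_to (R S : rngType) : Prop :=
  exists I : tsideal R, rng_isomorphic (factor_ring I) S.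

(* Unlike [GRing.subringClosed], not required to contain 1. *)
Record subrngClosed (A : pzRingType) := SubrngClosed {
  subrng_pred :> {pred A};
  subrng_zmod_closed : zmod_closed subrng_pred;
  subrng_mul_closed : GRing.mulr_2closed subrng_pred
}.

Record subrng (A : pzRingType) (S : subrngClosed A) := Subrng {
  subrng_val : A;
  subrng_valP : subrng_val \in subrng_pred S
}.

Section SubrngRing.
Variables (A : pzRingType) (S : subrngClosed A).

HB.instance Definition _ := [isSub for @subrng_val A S].
HB.instance Definition _ := [Choice of subrng S by <:].
HB.instance Definition _ :=
  GRing.SubChoice_isSubZmodule.Build A (subrng_pred S) (subrng S)
    (subrng_zmod_closed S).

Definition subrng_mul (x y : subrng S) : subrng S :=
  Subrng (subrng_mul_closed (subrng_valP x) (subrng_valP y)).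

Lemma subrng_mulA : associative subrng_mul.
Proof. by move=> x y z; apply: val_inj; rewrite /= mulrA. Qed.

Lemma subrng_mulDl : left_distributive subrng_mul +%R.
Proof. by move=> x y z; apply: val_inj; rewrite /= mulrDl. Qed.

Lemma subrng_mulDr : right_distributive subrng_mul +%R.
Proof. by move=> x y z; apply: val_inj; rewrite /= mulrDr. Qed.

HB.instance Definition _ :=
  Zmodule_isRng.Build (subrng S) subrng_mulA subrng_mulDl subrng_mulDr.

End SubrngRing.

Section Matrix2.
Variable A : pzRingType.

Definition mx2 (a b c d : A) : 'M[A]_2 :=
  \matrix_(i < 2, j < 2) nth 0 (nth [::] [:: [:: a; b]; [:: c; d]] i) j.

Lemma mx2B a b c d a' b' c' d' :
  mx2 a b c d - mx2 a' b' c' d' = mx2 (a - a') (b - b') (c - c') (d - d').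
Proof. by apply/matrixP=> -[[|[|]]//= ?] [[|[|]]//= ?]; rewrite !mxE. Qed.

Lemma mx2M a b c d a' b' c' d' :
  mx2 a b c d * mx2 a' b' c' d' =
  mx2 (a * a' + b * c') (a * b' + b * d') (c * a' + d * c') (c * b' + d * d').
Proof.
by apply/matrixP=> -[[|[|]]//= ?] [[|[|]]//= ?];
   rewrite !mxE !big_ord_recl big_ord0 !mxE addr0.
Qed.

Lemma mx20 : mx2 0 0 0 0 = 0.
Proof. by apply/matrixP=> -[[|[|]]//= ?] [[|[|]]//= ?]; rewrite !mxE. Qed.

End Matrix2.

Definition X_pred : {pred 'M['Z_4]_2} :=
  mem [:: mx2 0 0 0 0; mx2 2 0 0 0; mx2 0 0 0 2; mx2 2 0 0 2].

Definition Y_pred : {pred 'M['Z_2]_2} :=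
  mem [:: mx2 0 0 0 0; mx2 1 0 0 0; mx2 0 1 0 0; mx2 1 1 0 0].

Definition Z_pred : {pred 'M['Z_2]_2} :=
  mem [:: mx2 0 0 0 0; mx2 0 1 0 0; mx2 0 0 0 1; mx2 0 1 0 1].

Lemma in_seq4 (T : eqType) (a b c d x : T) :
  x \in [:: a; b; c; d] <-> [\/ x = a, x = b, x = c | x = d].
Proof.
split; first by rewrite !inE => /or4P[]/eqP->;
  [apply: Or41|apply: Or42|apply: Or43|apply: Or44].
by case=> ->; rewrite !inE eqxx ?orbT.
Qed.

Local Ltac closed_seq4 :=
  move=> x y /in_seq4[]-> /in_seq4[]->; apply/in_seq4; rewrite ?(mx2B, mx2M);
  first [ apply: Or41; congr mx2; exact: val_inj
        | apply: Or42; congr mx2; exact: val_inj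
        | apply: Or43; congr mx2; exact: val_inj
        | apply: Or44; congr mx2; exact: val_inj ].

Lemma X_zmod_closed : zmod_closed X_pred.
Proof. split; [by apply/in_seq4; apply: Or41; rewrite mx20 | closed_seq4]. Qed.
Lemma X_mul_closed : GRing.mulr_2closed X_pred.
Proof. closed_seq4. Qed.

Lemma Y_zmod_closed : zmod_closed Y_pred.
Proof. split; [by apply/in_seq4; apply: Or41; rewrite mx20 | closed_seq4]. Qed.
Lemma Y_mul_closed : GRing.mulr_2closed Y_pred.
Proof. closed_seq4. Qed.

Lemma Z_zmod_closed : zmod_closed Z_pred.
Proof. split; [by apply/in_seq4; apply: Or41; rewrite mx20 | closed_seq4]. Qed.
Lemma Z_mul_closed : GRing.mulr_2closed Z_pred.
Proof. closed_seq4. Qed.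

Definition X : rngType :=
  subrng (SubrngClosed X_zmod_closed X_mul_closed).
Definition Y : rngType :=
  subrng (SubrngClosed Y_zmod_closed Y_mul_closed).
Definition Z : rngType :=
  subrng (SubrngClosed Z_zmod_closed Z_mul_closed).

(* Main.v *)
(* By Scorza's argument, three proper subgroups covering an additive group are
   the preimages of the three lines under a surjection g onto the Klein
   four-group. If they are left ideals of R, then R acts on this quotient by
   scalars, that is g (x y) = f x * g y for a character f : R -> F_2. If f = 0,
   then g exhibits X as a factor ring. Otherwise pair f with a coordinate a of g
   different from f: (f, a) is onto and a (x y) = f x * a y, which is the
   multiplication of Y. The kernel of g itself need not be two-sided in this
   case. If the three subgroups are also right ideals, f x = 1 would make the one
   containing x contain x z, hence z, for every z, so f = 0. *)

From HB Require Import structures.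
Require Import Defs.
From mathcomp Require Import all_boot all_order all_algebra.
From mathcomp Require Import boolp classical_sets cardinality.

Import GRing.Theory.
Local Open Scope classical_set_scope.
Local Open Scope ring_scope.

(** * Finite covers as families indexed without repetition *)

Lemma cover_sizeP (R : rngType) (P : set R -> Prop) n :
  cover_size P n <->
  exists h : nat -> set R,
    [/\ forall i, (i < n)%N -> P (h i) /\ h i <> [set: R],
        forall x, exists2 i, (i < n)%N & h i x
      & {in `I_n &, injective h}].
Proof.
split=> [[C [[CP Ccov] Cn]]|[h [hP hcov hinj]]].
  have /card_set_bijP[h [hC hinj hsurj]] := card_esym Cn.
  exists h; split=> // [i ltin|x]; first exact/CP/hC.
  have [I CI Ix] : (\bigcup_(I in C) I) x by rewrite Ccov.
  by have [i ltin hi] := hsurj I CI; exists i => //; rewrite hi.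
exists (h @` `I_n); split; last exact: inj_card_eq.
split=> [_ [i ltin <-]|]; first exact: hP.
apply/seteqP; split=> // x _; have [i ltin hx] := hcov x.
by exists (h i) => //; exists i.
Qed.

(** * Covers by two or three additive subgroups *)

Section AdditiveSubgroups.
Context {R : rngType}.
Implicit Types A B C : set R.

Lemma additive_subgroupD {A} {x y : R} :
  additive_subgroup A -> A x -> A y -> A (x + y).
Proof.
move=> [A0 AB] Ax Ay; rewrite -[y]opprK; apply: (AB) => //.
by rewrite -sub0r; apply: AB.
Qed.

Lemma additive_subgroupDr {A} {x y : R} :
  additive_subgroup A -> A y -> A (x + y) -> A x.
Proof. by move=> [_ AB] Ay Axy; rewrite -[x](addrK y); apply: AB. Qed.

Lemma additive_subgroupDl {A} {x y : R} :
  additive_subgroup A -> A x -> A (x + y) -> A y.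
Proof. by rewrite addrC; apply: additive_subgroupDr. Qed.

Lemma proper_subset A : A <> [set: R] -> exists x, ~ A x.
Proof.
by move=> nA; apply/existsNP => AT; apply: nA; apply/seteqP; split.
Qed.

Lemma two_subgroups_not_cover A B :
  additive_subgroup A -> additive_subgroup B ->
  A <> [set: R] -> B <> [set: R] -> exists x, ~ A x /\ ~ B x.
Proof.
move=> sA sB /proper_subset[x nAx] /proper_subset[y nBy].
have [Bx|nBx] := pselect (B x); last by exists x.
have [Ay|nAy] := pselect (A y); last by exists y.
exists (x + y); split=> [/(additive_subgroupDr sA Ay)//|].
by move=> /(additive_subgroupDl sB Bx).
Qed.

(** Translation by an element [a] of [A] outside [B] and [C] exchanges the parts of [B] and [C]
    lying off [A], so two elements off [A] can be brought into the same subgroup. *)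
Lemma cover3_index2 A B C :
  additive_subgroup A -> additive_subgroup B -> additive_subgroup C ->
  B <> [set: R] -> C <> [set: R] -> (forall x, [\/ A x, B x | C x]) ->
  (forall x, B x -> C x -> A x) /\ (forall x y, ~ A x -> ~ A y -> A (x - y)).
Proof.
move=> sA sB sC pB pC cov.
have [a [nBa nCa]] := two_subgroups_not_cover _ _ sB sC pB pC.
have Aa : A a by case: (cov a).
have BCA x : B x -> C x -> A x.
  move=> Bx Cx; case: (cov (x + a)) => [|Bxa|Cxa].
  - exact: additive_subgroupDr.
  - by case: nBa; apply: additive_subgroupDl Bxa.
  - by case: nCa; apply: additive_subgroupDl Cxa.
have nAD x : ~ A x -> ~ A (x + a).
  by move=> nAx Axa; apply: nAx; apply: additive_subgroupDr Axa.
have BtoC x : ~ A x -> B x -> C (x + a).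
  move=> nAx Bx; case: (cov (x + a)) => [/(nAD _ nAx)//|Bxa|//].
  by case: nBa; apply: additive_subgroupDl Bxa.
have CtoB x : ~ A x -> C x -> B (x + a).
  move=> nAx Cx; case: (cov (x + a)) => [/(nAD _ nAx)//|//|Cxa].
  by case: nCa; apply: additive_subgroupDl Cxa.
have BB x y : ~ A x -> ~ A y -> B x -> B y -> A (x - y).
  move=> nAx nAy Bx By; apply: BCA; first exact: sB.2.
  have -> : x - y = (x + a) - (y + a) by rewrite opprD addrACA subrr addr0.
  by apply: sC.2; apply: BtoC.
have CC x y : ~ A x -> ~ A y -> C x -> C y -> A (x - y).
  move=> nAx nAy Cx Cy; apply: BCA; last exact: sC.2.
  have -> : x - y = (x + a) - (y + a) by rewrite opprD addrACA subrr addr0.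
  by apply: sB.2; apply: CtoB.
split=> // x y nAx nAy.
case: (cov x) => [/nAx//|Bx|Cx]; case: (cov y) => [/nAy//|By|Cy];
  [exact: BB| | |exact: CC].
  (* In the mixed cases [x] is first shifted by [a]; since [a] lies in [A], the conclusion for
     [x + a] gives that for [x]. *)
  have := CC _ _ (nAD _ nAx) nAy (BtoC _ nAx Bx) Cy.
  by rewrite addrAC => /(additive_subgroupDr sA Aa).
have := BB _ _ (nAD _ nAx) nAy (CtoB _ nAx Cx) By.
by rewrite addrAC => /(additive_subgroupDr sA Aa).
Qed.

(** Here [bool] is F_2 with exclusive or as addition, and [A] is the kernel. *)
Lemma index2_character A :
  additive_subgroup A -> (forall x y, ~ A x -> ~ A y -> A (x - y)) ->
  {morph (fun x => ~~ `[< A x >]) : x y / x + y}.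
Proof.
move=> sA A2 x y; rewrite [RHS]/=.
case: (asboolP (A x)) => Ax; case: (asboolP (A y)) => Ay; apply/asboolP.
- exact: additive_subgroupD.
- by move=> Axy; apply: Ay; apply: additive_subgroupDl Axy.
- by move=> Axy; apply: Ax; apply: additive_subgroupDr Axy.
- rewrite -[y]opprK; apply: A2 => // ANy; apply: Ay.
  by rewrite -[y]opprK -sub0r; apply: sA.2 => //; apply: sA.1.
Qed.

End AdditiveSubgroups.

(** * Three-member covers and surjections onto the Klein four-group *)

(** Distinct nonzero characters are linearly independent over F_2. A point separating them is added
    wherever one value has to be flipped alone. *)
Lemma characters_jointly_surjective {V : zmodType} (a b : V -> bool) :
  {morph a : x y / x + y} -> {morph b : x y / x + y} ->
  (exists x, a x) -> (exists x, b x) -> (exists x, a x != b x) ->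
  forall u, exists x, (a x, b x) = u.
Proof.
move=> aD bD [x ax] [y yb] [z abz].
have a0 : a 0 = false by have := aD 0 0; rewrite addr0; case: (a 0).
have b0 : b 0 = false by have := bD 0 0; rewrite addr0; case: (b 0).
case=> [[] []].
- move: abz; case az: (a z); case bz: (b z) => // _.
    case ay: (a y); first by exists y; rewrite ay yb.
    by exists (y + z); rewrite aD bD ay yb az bz.
  case bx: (b x); first by exists x; rewrite ax bx.
  by exists (x + z); rewrite aD bD ax bx az bz.
- move: abz; case az: (a z); case bz: (b z) => // _.
    by exists z; rewrite az bz.
  case bx: (b x); last by exists x; rewrite ax bx.
  by exists (x + z); rewrite aD bD ax bx az bz.
- move: abz; case az: (a z); case bz: (b z) => // _; last first.
    by exists z; rewrite az bz.
  case ay: (a y); last by exists y; rewrite ay yb.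
  by exists (y + z); rewrite aD bD ay yb az bz.
- by exists 0; rewrite a0 b0.
Qed.

(* The three subgroups of order 2 of the Klein four-group are numbered 0, 1, 2;
   any index above 2 also denotes the last one. *)
Definition klein_line (i : nat) (u : bool * bool) : bool :=
  match i with 0 => ~~ u.1 | 1 => ~~ u.2 | _ => u.1 == u.2 end.

Lemma cover3_klein {R : rngType} (P : set R -> Prop) :
  (forall I, P I -> additive_subgroup I) -> cover_size P 3 ->
  exists g : R -> bool * bool,
    [/\ {morph g : x y / x + y}, forall u, exists x, g x = u
      & forall i, (i < 3)%N -> P (fun x => klein_line i (g x))].
Proof.
move=> Psub /cover_sizeP[h [hP hcov _]].
have [PA pA] := hP 0 isT; have [PB pB] := hP 1 isT; have [PC pC] := hP 2 isT.
have cov x : [\/ h 0 x, h 1 x | h 2 x].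
  by have [[|[|[|]]]// _ hx] := hcov x; [apply: Or31|apply: Or32|apply: Or33].
have [BCA A2] :=
  cover3_index2 _ _ _ (Psub _ PA) (Psub _ PB) (Psub _ PC) pB pC cov.
have [ACB B2] : (forall x, h 0 x -> h 2 x -> h 1 x) /\
    (forall x y, ~ h 1 x -> ~ h 1 y -> h 1 (x - y)).
  apply: cover3_index2 => //; try exact: Psub.
  by move=> x; case: (cov x) => ?; [apply: Or32|apply: Or31|apply: Or33].
have [ABC _] : (forall x, h 0 x -> h 1 x -> h 2 x) /\
    (forall x y, ~ h 2 x -> ~ h 2 y -> h 2 (x - y)).
  apply: cover3_index2 => //; try exact: Psub.
  by move=> x; case: (cov x) => ?; [apply: Or32|apply: Or33|apply: Or31].
have aD := index2_character _ (Psub _ PA) A2.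
have bD := index2_character _ (Psub _ PB) B2.
exists (fun x => (~~ `[< h 0 x >], ~~ `[< h 1 x >])); split.
- by move=> x y; congr pair; [exact: aD|exact: bD].
- apply: characters_jointly_surjective => //.
  + by have [x nx] := proper_subset _ pA; exists x; apply/asboolP.
  + by have [x nx] := proper_subset _ pB; exists x; apply/asboolP.
  + have [x nx] := proper_subset _ pC; exists x; move: (cov x) (ABC x).
    by case: asboolP => a; case: asboolP => b // [] // _ /(_ a b).
(* [h 2] is where the two coordinates agree: each pairwise intersection lies in the remaining
   subgroup, and what is outside the first two is in the third. *)
- have E i x : (i < 3)%N ->
      klein_line i (~~ `[< h 0 x >], ~~ `[< h 1 x >]) = `[< h i x >].
    case: i => [|[|[|]]] //= _; rewrite ?negbK //.
    case: (asboolP (h 0 x)) => a; case: (asboolP (h 1 x)) => b;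
      apply/esym/asboolP.
    + exact: ABC.
    + by move=> c; apply: b; apply: ACB.
    + by move=> c; apply: a; apply: BCA.
    + by case: (cov x).
  move=> i lti; rewrite (_ : (fun x => _) = h i); first by have [] := hP i lti.
  by apply/funext => x; rewrite E // asboolE.
Qed.

Lemma least3P {R : rngType} (P : set R -> Prop) :
  (forall I, P I -> additive_subgroup I) ->
  least (cover_size P) = Some 3 <-> cover_size P 3.
Proof.
move=> Psub; rewrite leastP; split=> [[]//|P3]; split=> // m /cover_sizeP.
case: m => [|[|[|]]] // [h [hP hcov _]].
- by have [] := hcov 0.
- have [_ pA] := hP 0 isT; have [x nx] := proper_subset _ pA.
  by have [[|]] := hcov x.
- have [PA pA] := hP 0 isT; have [PB pB] := hP 1 isT.
  have [x []] := two_subgroups_not_cover _ _ (Psub _ PA) (Psub _ PB) pA pB.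
  by have [[|[|]]] := hcov x.
Qed.

Lemma klein_cover3 {R : rngType} (P : set R -> Prop) (g : R -> bool * bool) :
  (forall u, exists x, g x = u) ->
  (forall i, P (fun x => klein_line i (g x))) -> cover_size P 3.
Proof.
move=> gsurj gP; apply/cover_sizeP.
exists (fun i x => klein_line i (g x)); split.
- move=> i lti; split=> // /seteqP[_ /= E].
  have [u nu] : exists u, ~~ klein_line i u.
    by move: i lti E => [|[|[|]]] // _ _;
      [exists (true, true)|exists (true, true)|exists (true, false)].
  by have [x gx] := gsurj u; have := E x I; rewrite gx (negPf nu).
- by move=> x; case: (g x) => [[] []]; [exists 2|exists 1|exists 0|exists 0].
(* Which of these two points a line contains determines the line. *)
- have [x gx] := gsurj (true, false); have [y gy] := gsurj (false, true).
  have sep i j : (fun x => klein_line i (g x)) =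
      (fun x => klein_line j (g x)) :> set R ->
      klein_line i (true, false) = klein_line j (true, false) /\
      klein_line i (false, true) = klein_line j (false, true).
    move=> /seteqP[Eij Eji]; have := (Eij x, Eji x, Eij y, Eji y).
    rewrite /= gx gy => -[[[x1 x2] y1] y2].
    by split; apply/idP/idP.
  move=> i j; rewrite !inE /= => lti ltj /sep.
  by case: i lti => [|[|[|]]] // _; case: j ltj => [|[|[|]]] // _ [].
Qed.

(** * Factor rings of order four as multiplication laws on F_2 x F_2 *)

Lemma factor_ringP (R S : rngType) :
  has_factor_ring_isomorphic_to R S <->
  exists f : R -> S,
    [/\ {morph f : x y / x + y}, {morph f : x y / x ** y}
      & forall u, exists x, f x = u].
Proof.
split=> [[I [f [fD fM [f' fK f'K]]]]|[f [fD fM fsurj]]].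
  exists (fun x => f (coset I x)); split=> [x y|x y|u].
  - by rewrite cosetD fD.
  - by rewrite cosetM fM.
  - by exists (coset_repr (f' u)); rewrite coset_reprK f'K.
have f0 : f 0 = 0 by apply: (addIr (f 0)); rewrite -fD !add0r.
have fB x y : f (x - y) = f x - f y by apply: (addIr (f y)); rewrite -fD !subrK.
have r0 (T : rngType) (x : T) : x ** 0 = 0.
  by rewrite -[0 in LHS](subrr 0) rngmulBr subrr.
have l0 (T : rngType) (x : T) : 0 ** x = 0.
  by rewrite -[0 in LHS](subrr 0) rngmulBl subrr.
have sub : additive_subgroup [set x | f x = 0].
  by split=> [|x y /= fx fy]; rewrite //= fB fx fy subrr.
have ideal : two_sided_ideal [set x | f x = 0].
  by split; split=> // a x /= fx; rewrite fM fx ?r0 ?l0.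
pose I := TSIdeal ideal.
have fE x y : f x = f y <-> coset I x = coset I y.
  rewrite coset_eqP /= fB.
  by split=> [->|/eqP]; rewrite ?subrr// subr_eq0 => /eqP.
exists I, (fun u => f (coset_repr u)); split=> [u v|u v|].
- by rewrite -fD; apply/fE; rewrite cosetD !coset_reprK.
- by rewrite -fM; apply/fE; rewrite cosetM !coset_reprK.
(* A section of [f] supplies the inverse of the induced map on cosets. *)
have [s sK] := choice fsurj.
exists (fun u => coset I (s u)) => u; last first.
  by rewrite -[RHS]sK; apply/fE; rewrite coset_reprK.
by rewrite -[RHS]coset_reprK; apply/fE; rewrite sK.
Qed.

(** The multiplication is a bare operation [m], so that one additive group F_2 x F_2 serves for [X],
    [Y] and [Z]. *)
Definition klein_quotient (R : rngType)
    (m : bool * bool -> bool * bool -> bool * bool) : Prop :=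
  exists g : R -> bool * bool,
    [/\ {morph g : x y / x + y}, {morph g : x y / x ** y >-> m x y}
      & forall u, exists x, g x = u].

Lemma klein_factor_ring (R S : rngType) m (i : bool * bool -> S) :
  bijective i -> {morph i : u v / u + v} ->
  {morph i : u v / m u v >-> u ** v} ->
  has_factor_ring_isomorphic_to R S <-> klein_quotient R m.
Proof.
move=> [k iK kK] iD iM; rewrite factor_ringP.
split=> [[f [fD fM fsurj]]|[g [gD gM gsurj]]].
  exists (fun x => k (f x)); split=> [x y|x y|u].
  - by apply: (can_inj iK); rewrite iD !kK fD.
  - by apply: (can_inj iK); rewrite iM !kK fM.
  - by have [x fx] := fsurj (i u); exists x; rewrite fx iK.
exists (fun x => i (g x)); split=> [x y|x y|u]; [by rewrite gD|by rewrite gM|].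
by have [x gx] := gsurj (k u); exists x; rewrite gx kK.
Qed.

Lemma mx2D (A : pzRingType) (a b c d a' b' c' d' : A) :
  mx2 a b c d + mx2 a' b' c' d' = mx2 (a + a') (b + b') (c + c') (d + d').
Proof. by apply/matrixP=> -[[|[|]]//= ?] [[|[|]]//= ?]; rewrite !mxE. Qed.

(** The entries of [X] are 0 or 2 modulo 4, so all its products vanish. *)
Definition X_mul (u v : bool * bool) : bool * bool := (false, false).
(* [u.1] is the coordinate on the idempotent e11 and [u.2] the one on the
   nilpotent e12; with e22 in place of e11 the same law, reversed, is that of
   [Z]. *)
Definition Y_mul (u v : bool * bool) : bool * bool := (u.1 && v.1, u.1 && v.2).

Lemma factor_X (R : rngType) :
  has_factor_ring_isomorphic_to R X <-> klein_quotient R X_mul.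
Proof.
have iP (u : bool * bool) :
    mx2 (if u.1 then 2 else 0) 0 0 (if u.2 then 2 else 0) \in X_pred.
  by case: u => [[] []]; apply/in_seq4;
    [apply: Or44|apply: Or42|apply: Or43|apply: Or41].
pose i u : X :=
  @Subrng _ (SubrngClosed X_zmod_closed X_mul_closed) _ (iP u).
pose k (x : X) := (val x ord0 ord0 != 0, val x ord_max ord_max != 0).
have iK : cancel i k by case=> [[] []]; rewrite /k /= !mxE.
apply: (@klein_factor_ring _ _ _ i).
- exists k => // x; apply: val_inj.
  by have /in_seq4[] := subrng_valP x; rewrite /k /= => ->; rewrite !mxE.
- move=> [[] []] [[] []]; apply: val_inj; rewrite /= mx2D;
  by congr mx2; apply: val_inj.
- move=> [[] []] [[] []]; apply: val_inj; rewrite /= mx2M;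
  by congr mx2; apply: val_inj.
Qed.

Lemma factor_Y (R : rngType) :
  has_factor_ring_isomorphic_to R Y <-> klein_quotient R Y_mul.
Proof.
have iP (u : bool * bool) :
    mx2 (if u.1 then 1 else 0) (if u.2 then 1 else 0) 0 0 \in Y_pred.
  by case: u => [[] []]; apply/in_seq4;
    [apply: Or44|apply: Or42|apply: Or43|apply: Or41].
pose i u : Y :=
  @Subrng _ (SubrngClosed Y_zmod_closed Y_mul_closed) _ (iP u).
pose k (x : Y) := (val x ord0 ord0 != 0, val x ord0 ord_max != 0).
have iK : cancel i k by case=> [[] []]; rewrite /k /= !mxE.
apply: (@klein_factor_ring _ _ _ i).
- exists k => // x; apply: val_inj.
  by have /in_seq4[] := subrng_valP x; rewrite /k /= => ->; rewrite !mxE.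
- move=> [[] []] [[] []]; apply: val_inj; rewrite /= mx2D;
  by congr mx2; apply: val_inj.
- move=> [[] []] [[] []]; apply: val_inj; rewrite /= mx2M;
  by congr mx2; apply: val_inj.
Qed.

Lemma factor_Z (R : rngType) :
  has_factor_ring_isomorphic_to R Z <-> klein_quotient R (fun u v => Y_mul v u).
Proof.
have iP (u : bool * bool) :
    mx2 0 (if u.2 then 1 else 0) 0 (if u.1 then 1 else 0) \in Z_pred.
  by case: u => [[] []]; apply/in_seq4;
    [apply: Or44|apply: Or43|apply: Or42|apply: Or41].
pose i u : Z :=
  @Subrng _ (SubrngClosed Z_zmod_closed Z_mul_closed) _ (iP u).
pose k (x : Z) := (val x ord_max ord_max != 0, val x ord0 ord_max != 0).
have iK : cancel i k by case=> [[] []]; rewrite /k /= !mxE.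
apply: (@klein_factor_ring _ _ _ i).
- exists k => // x; apply: val_inj.
  by have /in_seq4[] := subrng_valP x; rewrite /k /= => ->; rewrite !mxE.
- move=> [[] []] [[] []]; apply: val_inj; rewrite /= mx2D;
  by congr mx2; apply: val_inj.
- move=> [[] []] [[] []]; apply: val_inj; rewrite /= mx2M;
  by congr mx2; apply: val_inj.
Qed.

(** * Ideals that are preimages of the three lines *)

Lemma klein_line_subgroup {R : rngType} (g : R -> bool * bool) i :
  {morph g : x y / x + y} -> additive_subgroup (fun x => klein_line i (g x)).
Proof.
move=> gD; have g0 : g 0 = 0 by apply: (addIr (g 0)); rewrite -gD !add0r.
have gB x y : g (x - y) = g x - g y by apply: (addIr (g y)); rewrite -gD !subrK.
split=> [|x y]; first by rewrite g0; case: i => [|[|]].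
rewrite gB; case: (g x) (g y) => [[] []] [[] []];
  by case: i => [|[|]].
Qed.

(* Left multiplication induces endomorphisms of the Klein four-group
   preserving its three lines; these are only 0 and the identity. *)
Lemma left_ideals_scalar {R : rngType} (g : R -> bool * bool) :
  {morph g : x y / x + y} -> (forall u, exists x, g x = u) ->
  (forall i, (i < 3)%N -> left_ideal (fun x => klein_line i (g x))) ->
  exists f : R -> bool, {morph f : x y / x + y} /\
    forall x y, g (x ** y) = (f x && (g y).1, f x && (g y).2).
Proof.
move=> gD gsurj gI; have [c gc] := gsurj (true, true).
(* The kernel of [g] is the intersection of two of the left ideals, so left multiplication descends
   to the quotient. *)
have gE y z : g y = g z -> forall x, g (x ** y) = g (x ** z).
  move=> Eyz x; have gyz : g (y - z) = (false, false).
    have := gD (y - z) z; rewrite subrK Eyz.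
    by case: (g z) (g (y - z)) => [[] []] [[] []].
  have := gD (x ** (y - z)) (x ** z); rewrite -rngmulDr subrK => ->.
  have := (gI 0 isT).2 x (y - z); have := (gI 1 isT).2 x (y - z).
  rewrite gyz /=; case: (g (x ** (y - z))) => [[] []];
  by move=> /(_ isT) // _ /(_ isT) // _; rewrite add0r.
(* The scalar is read off at [c], whose coordinates are both 1. *)
exists (fun x => (g (x ** c)).1); split=> [x y|x y].
  by rewrite rngmulDl gD.
have [e ge] := gsurj (true, false); have [d gd] := gsurj (false, true).
have Ec : g (x ** c) = g (x ** e) + g (x ** d).
  by rewrite -gD -rngmulDr; apply: gE; rewrite gD gc ge gd.
have := (gI 0 isT).2 x d; have := (gI 1 isT).2 x e; have := (gI 2 isT).2 x c.
rewrite Ec gc ge gd /= => /(_ isT) H2 /(_ isT) H1 /(_ isT) H0.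
case Ey: (g y) => [[] []] /=; rewrite ?andbT ?andbF.
- rewrite (gE _ c) ?gc // Ec.
  by move: H0 H1 H2; case: (g (x ** e)) (g (x ** d)) => [[] []] [[] []].
- rewrite (gE _ e) ?ge //.
  by move: H0 H1 H2; case: (g (x ** e)) (g (x ** d)) => [[] []] [[] []].
- rewrite (gE _ d) ?gd //.
  by move: H0 H1 H2; case: (g (x ** e)) (g (x ** d)) => [[] []] [[] []].
- have := (gI 0 isT).2 x y; have := (gI 1 isT).2 x y; rewrite Ey /=.
  by case: (g (x ** y)) => [[] []] /(_ isT) // _ /(_ isT).
Qed.

Lemma eta3 (R : rngType) : eta R = Some 3 <-> klein_quotient R X_mul.
Proof.
have sub I : two_sided_ideal I -> additive_subgroup (I : set R) by case=> -[].
rewrite /eta least3P //; split=> [/(cover3_klein _ sub)[g [gD gsurj gI]]|].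
  have [f [fD fM]] := left_ideals_scalar g gD gsurj (fun i lti => (gI i lti).1).
  exists g; split=> // x y; rewrite fM; suff -> : f x = false by [].
  apply/negP => fx; have gM z : g (x ** z) = g z by rewrite fM fx; case: (g z).
  have [i lti gx] : exists2 i, (i < 3)%N & klein_line i (g x).
    by case: (g x) => [[] []]; [exists 2|exists 1|exists 0|exists 0].
  have all z : klein_line i (g z) by rewrite -gM; apply: (gI i lti).2.2.
  (* No line contains both of these points. *)
  have [a ga] := gsurj (true, true); have [b gb] := gsurj (true, false).
  by move: (all a) (all b); rewrite ga gb; case: i {lti gx all} => [|[|]].
(* Conversely, every product maps to 0, which lies on each line. *)
case=> g [gD gM gsurj]; apply: (klein_cover3 _ g gsurj) => i.
have s := klein_line_subgroup g i gD.
by split; split=> // a x _; rewrite gM; case: i {s} => [|[|]].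
Qed.

Lemma eta_l3 (R : rngType) :
  eta_l R = Some 3 <-> klein_quotient R X_mul \/ klein_quotient R Y_mul.
Proof.
have sub I : left_ideal I -> additive_subgroup (I : set R) by case.
rewrite /eta_l least3P //; split=> [/(cover3_klein _ sub)[g [gD gsurj gI]]|].
  have [f [fD fM]] := left_ideals_scalar g gD gsurj gI.
  have [[x fx]|f0] := pselect (exists x, f x); last first.
    left; exists g; split=> // x y; rewrite fM.
    by have /negPf -> : ~~ f x by apply/negP => fx; apply: f0; exists x.
  (* Associativity, evaluated on [u ** v ** e] with both coordinates of [g e] equal to 1. *)
  right; have fmul u v : f (u ** v) = f u && f v.
    have [e ge] := gsurj (true, true); have := fM (u ** v) e.
    by rewrite -rngmulA !fM ge /= !andbT => -[].
  have mk (a : R -> bool) : {morph a : u v / u + v} -> (exists u, a u) ->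
      (exists u, f u != a u) -> (forall u v, a (u ** v) = f u && a v) ->
      klein_quotient R Y_mul.
    move=> aD a1 fa aM; exists (fun u => (f u, a u)); split.
    - by move=> u v; rewrite fD aD.
    - by move=> u v; rewrite fmul aM.
    - by apply: characters_jointly_surjective => //; exists x.
  have [e ge] := gsurj (true, false); have [d gd] := gsurj (false, true).
  (* The coordinates of [g e] differ, so the value of [f e] decides which of them is certainly
     distinct from [f]. *)
  case fe: (f e).
    apply: (mk (fun u => (g u).2)); last by move=> u v; rewrite fM.
    - by move=> u v; rewrite gD.
    - by exists d; rewrite gd.
    - by exists e; rewrite fe ge.
  apply: (mk (fun u => (g u).1)); last by move=> u v; rewrite fM.
  - by move=> u v; rewrite gD.
  - by exists e; rewrite ge.
  - by exists e; rewrite fe ge.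
(* Under either law, left multiplication acts on the quotient as 0 or the identity and so preserves
   each line. *)
by case=> -[g [gD gM gsurj]]; apply: (klein_cover3 _ g gsurj) => i;
  split; [exact: klein_line_subgroup| |exact: klein_line_subgroup|] => a x;
  rewrite gM; case: (g a) (g x) => [[] []] [[] []]; case: i => [|[|]].
Qed.

(** * Right ideals through the opposite ring *)

Definition opposite_rng (R : rngType) : Type := R.

Section OppositeRng.
Variable R : rngType.

HB.instance Definition _ := GRing.Zmodule.on (opposite_rng R).

Let mul (x y : opposite_rng R) : opposite_rng R := (y : R) ** (x : R).

Let mulA : associative mul.
Proof. by move=> x y z; rewrite /mul rngmulA. Qed.

Let mulDl : left_distributive mul +%R.
Proof. by move=> x y z; apply: rngmulDr. Qed.

Let mulDr : right_distributive mul +%R.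
Proof. by move=> x y z; apply: rngmulDl. Qed.

HB.instance Definition _ :=
  Zmodule_isRng.Build (opposite_rng R) mulA mulDl mulDr.

End OppositeRng.

Lemma klein_quotient_opposite (R : rngType) m :
  klein_quotient (opposite_rng R : rngType) m <->
  klein_quotient R (fun u v => m v u).
Proof. by split=> -[g [gD gM gs]]; exists g; split=> // x y; apply: gM. Qed.

Local Close Scope ring_scope.
Local Close Scope classical_set_scope.

Theorem corollary1p2 (R : rngType) :
  [/\ eta R = Some 3 <-> has_factor_ring_isomorphic_to R X,
      eta_l R = Some 3 <->
        has_factor_ring_isomorphic_to R X \/ has_factor_ring_isomorphic_to R Y
    & eta_r R = Some 3 <->
        has_factor_ring_isomorphic_to R X \/ has_factor_ring_isomorphic_to R Z].
Proof.
have or_iff (A B A' B' : Prop) :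
    (A <-> A') -> (B <-> B') -> A \/ B <-> A' \/ B'.
  by move=> -> ->.
split; first exact: iff_trans (eta3 R) (iff_sym (factor_X R)).
  apply: (iff_trans (eta_l3 R)).
  exact: or_iff (iff_sym (factor_X R)) (iff_sym (factor_Y R)).
(* By conversion, right ideals of [R] are left ideals of the opposite ring. Reversal fixes the law
   of [X] and turns that of [Y] into that of [Z]. *)
apply: (iff_trans (eta_l3 (opposite_rng R : rngType))).
apply: or_iff; apply: (iff_trans (klein_quotient_opposite R _)); apply: iff_sym.
  exact: factor_X.
exact: factor_Z.
Qed.
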